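(* Let $I=(0,1)$, $\mu>0$, $\gamma>1$, $\rho_0\in C(\bar I)$ with $\rho_0>0$ in $I$, $\rho_0=0$ on $\partial I$, and $u_0,e_0$ continuous with $e_0\ge0$, $e_0\not\equiv0$ in $I$. Suppose that there exist positive $\lambda_5,\lambda_6,\lambda_7,\lambda_8$ with $0<\lambda_7,\lambda_8<1$ such that either ($\frac{(\rho_0)_x}{\rho_0}+\frac{(e_0)_x}{\rho_0}\ge\lambda_5$ in $(0,\lambda_7)$, $u_0(\lambda_7)<0$, $u_0\le0$ in $(0,\lambda_7)$) or ($\frac{(\rho_0)_x}{\rho_0}+\frac{(e_0)_x}{\rho_0}\le-\lambda_6$ in $(\lambda_8,1)$, $u_0(\lambda_8)>0$, $u_0\ge0$ in $(\lambda_8,1)$). Then for every $T>0$ the problem $$\rho_t+(\rho u)_x=0,\quad (\rho u)_t+(\rho u^2+p)_x=\mu u_{xx},\quad (\rho e)_t+(\rho e u)_x+p u_x=\mu u_x^2\quad\text{in } I\times(0,T],$$ with $p=(\gamma-1)\rho e$, $(\rho,u,e)=(\rho_0,u_0,e_0)$ on $I\times\{t=0\}$ and $\rho=u=u_x=0$ on $\partial I\times(0,T]$, has no solution $(\rho,u,e)$ in $C^{2,1}(\bar I\times[0,T])$.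
   Context: $C^{2,1}(\bar I\times[0,T])$ denotes functions that are $C^2$ in $x$ and $C^1$ in $t$ on $\bar I\times[0,T]$. *)

(* Defs.v *)
From Stdlib Require Import Reals Lra.
Open Scope R_scope.

Definition in_rect (T x t : R) : Prop := 0 <= x <= 1 /\ 0 <= t <= T.

Definition cont_rect (T : R) (f : R -> R -> R) : Prop :=
  forall x t, in_rect T x t ->
  forall eps, 0 < eps -> exists delta, 0 < delta /\
    forall y s, in_rect T y s -> Rabs (y - x) < delta -> Rabs (s - t) < delta ->
      Rabs (f y s - f x t) < eps.

Definition pdx_rect (T : R) (f g : R -> R -> R) : Prop :=
  forall x t, in_rect T x t ->
  forall eps, 0 < eps -> exists delta, 0 < delta /\
    forall h, h <> 0 -> Rabs h < delta -> 0 <= x + h <= 1 ->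
      Rabs ((f (x + h) t - f x t) / h - g x t) < eps.

Definition pdt_rect (T : R) (f g : R -> R -> R) : Prop :=
  forall x t, in_rect T x t ->
  forall eps, 0 < eps -> exists delta, 0 < delta /\
    forall h, h <> 0 -> Rabs h < delta -> 0 <= t + h <= T ->
      Rabs ((f x (t + h) - f x t) / h - g x t) < eps.

Definition C21_rect (T : R) (f fx fxx ft : R -> R -> R) : Prop :=
  cont_rect T f /\ cont_rect T fx /\ cont_rect T fxx /\ cont_rect T ft /\
  pdx_rect T f fx /\ pdx_rect T fx fxx /\ pdt_rect T f ft.

Definition cont_I (f : R -> R) : Prop :=
  forall x, 0 <= x <= 1 ->
  forall eps, 0 < eps -> exists delta, 0 < delta /\
    forall y, 0 <= y <= 1 -> Rabs (y - x) < delta -> Rabs (f y - f x) < eps.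

(* (rho,u,e) is a C^{2,1}([0,1]x[0,T]) solution of the Navier-Stokes system
   with initial data (rho0,u0,e0) and boundary conditions rho=u=u_x=0.
   Derivatives of products are written out by the product rule
   (valid since all components are C^{2,1}); p = (gamma-1) rho e. *)
Definition is_C21_solution (mu gamma T : R) (rho0 u0 e0 : R -> R)
    (rho u e : R -> R -> R) : Prop :=
  exists rx rxx rt ux uxx ut ex exx et : R -> R -> R,
    C21_rect T rho rx rxx rt /\
    C21_rect T u ux uxx ut /\
    C21_rect T e ex exx et /\
    (forall x t, 0 < x < 1 -> 0 < t <= T ->
       let p := (gamma - 1) * rho x t * e x t in
       let px := (gamma - 1) * (rx x t * e x t + rho x t * ex x t) in
       rt x t + (rx x t * u x t + rho x t * ux x t) = 0 /\
       (rt x t * u x t + rho x t * ut x t)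
         + (rx x t * (u x t)^2 + 2 * rho x t * u x t * ux x t + px)
         = mu * uxx x t /\
       (rt x t * e x t + rho x t * et x t)
         + (rx x t * e x t * u x t + rho x t * ex x t * u x t
            + rho x t * e x t * ux x t)
         + p * ux x t = mu * (ux x t)^2) /\
    (forall x, 0 < x < 1 -> rho x 0 = rho0 x /\ u x 0 = u0 x /\ e x 0 = e0 x) /\
    (forall t, 0 < t <= T ->
       rho 0 t = 0 /\ rho 1 t = 0 /\ u 0 t = 0 /\ u 1 t = 0 /\
       ux 0 t = 0 /\ ux 1 t = 0).

(* Main.v *)
Require Import Defs.
From Stdlib Require Import Reals Lra Psatz ClassicalEpsilon.
From Coquelicot Require Import Coquelicot.
Open Scope R_scope.

(** Let W(x,t) be the momentum of the gas in (0,x), the integral of rho u.  The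
    momentum equation and the conditions at x = 0 give W_t + rho u^2 + p = mu u_x.
    Since rho and p are nonnegative (maximum principle for the transport equations
    of rho and rho e), W is a subsolution of a degenerate parabolic equation.  The
    sign of u_0 makes W <= 0 initially on (0,lam7) and W(lam7,t) < 0 for small t,
    so a Hopf-type argument forces u(0,t) < 0 for some t, against u = 0 at the
    boundary.  The comparison function is the integral of rho z with
    z = eps (exp(al lam) - exp(al x + be t)), be of order al^2: for large al it is
    a strict supersolution, nonnegative initially, with z(0,t) < 0 after an
    arbitrarily short time.  The case of a sign condition near x = 1 reduces to
    this one by x -> 1 - x, u -> -u. *)

(** * Continuity on the plane and extension from the closed rectangle *)

Definition cont2 (f : R -> R -> R) : Prop :=
  forall x t, continuity_2d_pt f x t.

Definition clamp (b x : R) : R := Rmax 0 (Rmin b x).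

(* Clamping makes a function given on the closed rectangle continuous on the
   whole plane, so that one-sided limits never occur. *)
Definition ext (T : R) (f : R -> R -> R) (x t : R) : R :=
  f (clamp 1 x) (clamp T t).

Lemma clamp_id (b x : R) : 0 <= x <= b -> clamp b x = x.
Proof. intros H; unfold clamp, Rmax, Rmin; repeat destruct Rle_dec; lra. Qed.

Lemma clamp_range (b x : R) : 0 <= b -> 0 <= clamp b x <= b.
Proof. intros H; unfold clamp, Rmax, Rmin; repeat destruct Rle_dec; lra. Qed.

Lemma clamp_lip (b x y : R) : Rabs (clamp b x - clamp b y) <= Rabs (x - y).
Proof.
unfold clamp, Rmax, Rmin, Rabs; repeat destruct Rle_dec;
  repeat destruct Rcase_abs; lra.
Qed.

Lemma ext_in (T : R) (f : R -> R -> R) (x t : R) :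
  0 <= x <= 1 -> 0 <= t <= T -> ext T f x t = f x t.
Proof. intros Hx Ht; unfold ext; now rewrite !clamp_id. Qed.

Lemma ext_cont2 (T : R) (f : R -> R -> R) :
  0 <= T -> cont_rect T f -> cont2 (ext T f).
Proof.
intros HT Hf x t eps.
destruct (Hf (clamp 1 x) (clamp T t)) with (eps := pos eps) as [d [Hd H]].
- split; apply clamp_range; lra.
- apply cond_pos.
- exists (mkposreal d Hd); simpl; intros y s Hy Hs.
  apply H.
  + split; apply clamp_range; lra.
  + eapply Rle_lt_trans; [apply clamp_lip | exact Hy].
  + eapply Rle_lt_trans; [apply clamp_lip | exact Hs].
Qed.

(** Clamping may create a kink at [x = 0] and [x = 1]. At an interior point small increments stay in
    [[0,1]], where it acts as the identity. *)
Lemma ext_is_derive_x (T : R) (f g : R -> R -> R) (x t : R) :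
  pdx_rect T f g -> 0 < x < 1 -> 0 <= t <= T ->
  is_derive (fun y => ext T f y t) x (ext T g x t).
Proof.
intros H Hx Ht; apply is_derive_Reals; intros eps Heps.
destruct (H x t) with (eps := eps) as [d [Hd Hh]]; [split; lra | exact Heps |].
assert (Hm : 0 < Rmin d (Rmin x (1 - x))) by (repeat apply Rmin_pos; lra).
exists (mkposreal _ Hm); simpl; intros h h0 Hlt.
assert (Rabs h < d) by (eapply Rlt_le_trans; [exact Hlt | apply Rmin_l]).
assert (Hlt' : Rabs h < Rmin x (1 - x))
  by (eapply Rlt_le_trans; [exact Hlt | apply Rmin_r]).
assert (Rabs h < x) by (eapply Rlt_le_trans; [exact Hlt' | apply Rmin_l]).
assert (Rabs h < 1 - x) by (eapply Rlt_le_trans; [exact Hlt' | apply Rmin_r]).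
assert (0 <= x + h <= 1) by (unfold Rabs in *; destruct (Rcase_abs h); lra).
rewrite !ext_in by lra.
now apply Hh.
Qed.

(** Here [x] may be any real: clamping turns it into a parameter of [[0,1]], and only [t] has to
    stay away from the ends. This uniformity in [x] serves the differentiation under the integral
    sign. *)
Lemma ext_is_derive_t (T : R) (f g : R -> R -> R) (x t : R) :
  pdt_rect T f g -> 0 < t < T ->
  is_derive (fun s => ext T f x s) t (ext T g x t).
Proof.
intros H Ht; apply is_derive_Reals; intros eps Heps.
assert (Hc := clamp_range 1 x Rle_0_1).
destruct (H (clamp 1 x) t) with (eps := eps) as [d [Hd Hh]];
  [split; lra | exact Heps |].
assert (Hm : 0 < Rmin d (Rmin t (T - t))) by (repeat apply Rmin_pos; lra).
exists (mkposreal _ Hm); simpl; intros h h0 Hlt.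
assert (Rabs h < d) by (eapply Rlt_le_trans; [exact Hlt | apply Rmin_l]).
assert (Hlt' : Rabs h < Rmin t (T - t))
  by (eapply Rlt_le_trans; [exact Hlt | apply Rmin_r]).
assert (Rabs h < t) by (eapply Rlt_le_trans; [exact Hlt' | apply Rmin_l]).
assert (Rabs h < T - t) by (eapply Rlt_le_trans; [exact Hlt' | apply Rmin_r]).
assert (0 <= t + h <= T) by (unfold Rabs in *; destruct (Rcase_abs h); lra).
unfold ext; rewrite !(clamp_id T) by lra.
now apply Hh.
Qed.

Lemma cont2_const (c : R) : cont2 (fun _ _ => c).
Proof. intros x t; apply continuity_2d_pt_const. Qed.

Lemma cont2_fst : cont2 (fun x _ => x).
Proof. intros x t; apply continuity_2d_pt_id1. Qed.

Lemma cont2_snd : cont2 (fun _ t => t).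
Proof. intros x t; apply continuity_2d_pt_id2. Qed.

Lemma cont2_plus (f g : R -> R -> R) :
  cont2 f -> cont2 g -> cont2 (fun x t => f x t + g x t).
Proof. intros Hf Hg x t; now apply continuity_2d_pt_plus. Qed.

Lemma cont2_minus (f g : R -> R -> R) :
  cont2 f -> cont2 g -> cont2 (fun x t => f x t - g x t).
Proof. intros Hf Hg x t; now apply continuity_2d_pt_minus. Qed.

Lemma cont2_opp (f : R -> R -> R) : cont2 f -> cont2 (fun x t => - f x t).
Proof. intros Hf x t; now apply continuity_2d_pt_opp. Qed.

Lemma cont2_mult (f g : R -> R -> R) :
  cont2 f -> cont2 g -> cont2 (fun x t => f x t * g x t).
Proof. intros Hf Hg x t; now apply continuity_2d_pt_mult. Qed.

Lemma cont2_exp (f : R -> R -> R) : cont2 f -> cont2 (fun x t => exp (f x t)).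
Proof.
intros Hf x t; apply continuity_1d_2d_pt_comp; [| apply Hf].
apply derivable_continuous_pt, derivable_pt_exp.
Qed.

Ltac cont2_tac :=
  repeat first
    [ assumption | apply cont2_const | apply cont2_fst | apply cont2_snd
    | apply cont2_plus | apply cont2_minus | apply cont2_opp
    | apply cont2_mult | apply cont2_exp ].

Lemma cont2_x (f : R -> R -> R) (x t : R) :
  cont2 f -> continuous (fun y => f y t) x.
Proof.
intros Hf; apply continuity_pt_filterlim; intros eps Heps.
destruct (Hf x t (mkposreal eps Heps)) as [d Hd].
exists d; split; [apply cond_pos |].
intros y [_ Hy]; apply Hd; [exact Hy |].
rewrite Rminus_diag, Rabs_R0; apply cond_pos.
Qed.

Lemma cont2_t (f : R -> R -> R) (x t : R) :
  cont2 f -> continuous (fun s => f x s) t.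
Proof.
intros Hf; apply continuity_pt_filterlim; intros eps Heps.
destruct (Hf x t (mkposreal eps Heps)) as [d Hd].
exists d; split; [apply cond_pos |].
intros y [_ Hy]; apply Hd; [| exact Hy].
rewrite Rminus_diag, Rabs_R0; apply cond_pos.
Qed.

Lemma cont2_ex_RInt (f : R -> R -> R) (t a b : R) :
  cont2 f -> ex_RInt (fun y => f y t) a b.
Proof.
intros Hf; apply (ex_RInt_continuous (V := R_CompleteNormedModule)).
intros z _; now apply cont2_x.
Qed.

(** * Maxima on a rectangle and the maximum principle for transport equations *)

(** The one-variable extreme value theorem is applied twice: first in [x] at each time, choosing a
    maximiser [m t], then in [t]. The choice [m] may jump, but the maximal value [f (m t) t] is
    continuous. *)
Lemma cont2_max (f : R -> R -> R) (a b : R) :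
  0 <= a -> 0 <= b -> cont2 f ->
  exists x0 t0, 0 <= x0 <= a /\ 0 <= t0 <= b /\
    forall x t, 0 <= x <= a -> 0 <= t <= b -> f x t <= f x0 t0.
Proof.
intros Ha Hb Hf.
assert (Hsec : forall t, exists x0, (forall x, 0 <= x <= a -> f x t <= f x0 t)
                                    /\ 0 <= x0 <= a).
{ intros t; apply (continuity_ab_maj (fun x => f x t)); [exact Ha |].
  intros c _; apply continuity_pt_filterlim; now apply (cont2_x f). }
set (m t := proj1_sig (constructive_indefinite_description _ (Hsec t))).
assert (Hm : forall t, (forall x, 0 <= x <= a -> f x t <= f (m t) t) /\ 0 <= m t <= a)
  by (intro t; exact (proj2_sig (constructive_indefinite_description _ (Hsec t)))).
clearbody m.
destruct (continuity_ab_maj (fun t => f (m t) t) 0 b) as [t0 [Ht0 Hr]];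
  [exact Hb | |].
- intros c Hc eps Heps.
  destruct (uniform_continuity_2d_1d f 0 a c (fun x _ => Hf x c)
              (mkposreal eps Heps)) as [d Hd].
  exists d; split; [apply cond_pos |].
  intros s [_ Hs]; simpl in Hs; unfold Rdist in Hs |- *; simpl; unfold Rdist.
  assert (Hs' : c - d <= s <= c + d)
    by (unfold Rabs in Hs; destruct (Rcase_abs (s - c)); lra).
  assert (Hcc : c - d <= c <= c + d) by (destruct d; simpl; lra).
  destruct (Hm s) as [Ms Rs]; destruct (Hm c) as [Mc Rc].
  assert (H1 : Rabs (f (m s) s - f (m s) c) < eps).
  { apply Hd; try assumption.
    rewrite Rminus_diag, Rabs_R0; apply cond_pos. }
  assert (H2 : Rabs (f (m c) s - f (m c) c) < eps).
  { apply Hd; try assumption.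
    rewrite Rminus_diag, Rabs_R0; apply cond_pos. }
  (* Each maximiser competes at the other time, which bounds the change of the maximum from both
     sides. *)
  specialize (Ms (m c) Rc); specialize (Mc (m s) Rs).
  apply Rabs_def2 in H1; apply Rabs_def2 in H2; apply Rabs_def1; lra.
- exists (m t0), t0; split; [apply Hm |]; split; [exact Hr |].
  intros x t Hx Ht; eapply Rle_trans; [now apply Hm | now apply Ht0].
Qed.

Lemma cont2_bounded (f : R -> R -> R) (a b : R) :
  0 <= a -> 0 <= b -> cont2 f ->
  exists M, 0 < M /\ forall x t, 0 <= x <= a -> 0 <= t <= b -> Rabs (f x t) <= M.
Proof.
intros Ha Hb Hf.
destruct (cont2_max f a b) as [x1 [t1 [_ [_ H1]]]]; try assumption.
destruct (cont2_max (fun x t => - f x t) a b) as [x2 [t2 [_ [_ H2]]]];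
  try assumption; [cont2_tac |].
exists (Rabs (f x1 t1) + Rabs (f x2 t2) + 1).
assert (A1 := Rabs_pos (f x1 t1)); assert (A2 := Rabs_pos (f x2 t2)).
split; [lra |]; intros x t Hx Ht.
specialize (H1 x t Hx Ht); specialize (H2 x t Hx Ht).
unfold Rabs in *; repeat destruct Rcase_abs; lra.
Qed.

(* The maximum may sit at [t0 = b], hence only [0 <= ft x0 t0]. *)
Lemma interior_max (f fx ft : R -> R -> R) (a b : R) :
  0 < a -> 0 < b -> cont2 f ->
  (forall x t, 0 < x < a -> 0 < t <= b ->
     is_derive (fun y => f y t) x (fx x t) /\ is_derive (fun s => f x s) t (ft x t)) ->
  (forall x, 0 <= x <= a -> f x 0 <= 0) ->
  (forall t, 0 <= t <= b -> f 0 t <= 0 /\ f a t <= 0) ->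
  (exists x t, 0 <= x <= a /\ 0 <= t <= b /\ 0 < f x t) ->
  exists x0 t0, 0 < x0 < a /\ 0 < t0 <= b /\ 0 < f x0 t0 /\
    fx x0 t0 = 0 /\ 0 <= ft x0 t0 /\
    forall x, 0 <= x <= a -> f x t0 <= f x0 t0.
Proof.
intros Ha Hb Hf Hd H0 Hbd [x1 [t1 [Hx1 [Ht1 Hp]]]].
destruct (cont2_max f a b) as [x0 [t0 [Hx0 [Ht0 Hm]]]]; [lra | lra | assumption |].
assert (Hpos : 0 < f x0 t0) by (specialize (Hm x1 t1 Hx1 Ht1); lra).
assert (t0 <> 0) by (intros ->; specialize (H0 x0 Hx0); lra).
assert (x0 <> 0) by (intros ->; specialize (Hbd t0 Ht0); lra).
assert (x0 <> a) by (intros ->; specialize (Hbd t0 Ht0); lra).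
destruct (Hd x0 t0) as [Dx Dt]; [lra | lra |].
exists x0, t0; repeat (split; [lra |]).
split; [| split; [| intros x Hx; now apply Hm]].
- apply is_derive_Reals in Dx.
  assert (E := uniqueness_limite _ _ _ _ Dx
    (derive_pt_eq_1 _ _ _ (exist _ _ Dx) eq_refl)).
  assert (Z : derive_pt (fun y => f y t0) x0 (exist _ _ Dx) = 0).
  { apply (deriv_maximum _ 0 a); try lra.
    intros y Hy1 Hy2; apply Hm; lra. }
  exact Z.
- apply is_derive_Reals in Dt.
  destruct (Rle_lt_dec 0 (ft x0 t0)) as [|Hneg]; [assumption | exfalso].
  (* This tolerance makes every difference quotient near [t0] negative, whereas backward quotients
     at a maximum are nonnegative. Backward steps remain in the rectangle even if [t0 = b]. *)
  destruct (Dt (- ft x0 t0)) as [d Hdd]; [lra |].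
  assert (Hmin : 0 < Rmin (d / 2) t0)
    by (apply Rmin_pos; [destruct d; simpl; lra | lra]).
  assert (Hl := Rmin_l (d / 2) t0); assert (Hr := Rmin_r (d / 2) t0).
  set (h := Rmin (d / 2) t0) in *.
  specialize (Hdd (- h)).
  assert (Hh : Rabs (- h) < d) by (rewrite Rabs_Ropp, Rabs_pos_eq; destruct d; simpl in *; lra).
  specialize (Hdd ltac:(lra) Hh).
  apply Rabs_def2 in Hdd.
  specialize (Hm x0 (t0 + - h) ltac:(lra) ltac:(lra)).
  assert (0 <= (f x0 (t0 + - h) - f x0 t0) / - h).
  { replace ((f x0 (t0 + - h) - f x0 t0) / - h)
      with ((f x0 t0 - f x0 (t0 + - h)) / h) by (field; lra).
    apply Rdiv_le_0_compat; lra. }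
  lra.
Qed.

(** At a negative minimum of [f] damped by [exp (- (K + 1) * s)] the transport term vanishes and the
    damping gives [ft <= (K + 1) * f]. Since [c >= - K], it follows that [ft + c * f <= f < 0],
    against the differential inequality. *)
Lemma transport_nonneg (T K : R) (f fx ft u c : R -> R -> R) :
  cont2 f ->
  (forall x t, 0 < x < 1 -> 0 < t < T ->
     is_derive (fun y => f y t) x (fx x t) /\ is_derive (fun s => f x s) t (ft x t)) ->
  (forall x t, 0 < x < 1 -> 0 < t < T -> Rabs (c x t) <= K) ->
  (forall x t, 0 < x < 1 -> 0 < t < T ->
     0 <= ft x t + u x t * fx x t + c x t * f x t) ->
  (forall x, 0 <= x <= 1 -> 0 <= f x 0) ->
  (forall t, 0 <= t < T -> 0 <= f 0 t /\ 0 <= f 1 t) ->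
  forall x t, 0 <= x <= 1 -> 0 <= t < T -> 0 <= f x t.
Proof.
intros Hf Hd Hc Heq H0 Hbd x t Hx Ht.
destruct (Rle_lt_dec 0 (f x t)) as [|Hneg]; [assumption | exfalso].
assert (Htp : 0 < t).
{ destruct (Req_dec t 0) as [-> |]; [specialize (H0 x Hx); lra | lra]. }
set (E s := exp (- (K + 1) * s)).
assert (HE : forall s, 0 < E s) by (intro; apply exp_pos).
(* Time is cut at the point [t < T] where [f] is negative, so that the time derivative exists up to
   and including the final time. *)
destruct (interior_max (fun y s => - (E s * f y s))
  (fun y s => - (E s * fx y s))
  (fun y s => - (E s * ft y s - (K + 1) * E s * f y s)) 1 t)
  as [x0 [t0 [Hx0 [Ht0 [Hp [Dx [Dt _]]]]]]].
- lra.
- lra.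
- unfold E; cont2_tac.
- intros y s Hy Hs; destruct (Hd y s) as [Dx Dt]; [lra | lra |].
  split.
  + apply (is_derive_opp (fun y => E s * f y s)).
    now apply is_derive_scal.
  + apply (is_derive_opp (fun s => E s * f y s)).
    unfold E; auto_derive; [now exists (ft y s) |].
    rewrite (is_derive_unique (fun s : R => f y s) _ _ Dt).
    ring.
- intros y Hy; specialize (H0 y Hy); specialize (HE 0); nra.
- intros s Hs; destruct (Hbd s) as [B0 B1]; [lra |]; specialize (HE s); split; nra.
- exists x, t; repeat split; try lra; specialize (HE t); nra.
- specialize (HE t0); specialize (Heq x0 t0 Hx0 ltac:(lra)).
  specialize (Hc x0 t0 Hx0 ltac:(lra)).
  assert (fx x0 t0 = 0) by nra.
  rewrite H in Heq.
  assert (f x0 t0 < 0) by nra.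
  assert (ft x0 t0 <= (K + 1) * f x0 t0) by nra.
  assert (- K <= c x0 t0) by (unfold Rabs in Hc; destruct Rcase_abs; lra).
  nra.
Qed.

(** * Integrals from 0 to [x] as functions of [x] and [t] *)

Lemma RInt_is_derive_bound (g : R -> R -> R) (x t : R) :
  cont2 g -> is_derive (fun z => RInt (fun y => g y t) 0 z) x (g x t).
Proof.
intros Hg; apply (is_derive_RInt (fun y => g y t) _ 0).
- apply filter_forall; intros z.
  apply (RInt_correct (V := R_CompleteNormedModule)); now apply cont2_ex_RInt.
- now apply cont2_x.
Qed.

Lemma RInt_is_derive_param (g gt : R -> R -> R) (x t T : R) :
  cont2 g -> cont2 gt -> 0 < t < T ->
  (forall y s, 0 < s < T -> is_derive (fun s => g y s) s (gt y s)) ->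
  is_derive (fun s => RInt (fun y => g y s) 0 x) t (RInt (fun y => gt y t) 0 x).
Proof.
intros Hg Hgt Ht Hd.
assert (Hm : 0 < Rmin t (T - t)) by (apply Rmin_pos; lra).
assert (Hl := Rmin_l t (T - t)); assert (Hr := Rmin_r t (T - t)).
assert (Hnear : forall s, Rabs (s - t) < Rmin t (T - t) -> 0 < s < T)
  by (intros s Hs; apply Rabs_def2 in Hs; lra).
(* The parametric theorem speaks of [Derive], which is known to equal [gt] only for times in
   [(0,T)]; continuity of [gt] is therefore transferred locally around [t]. *)
replace (RInt (fun y => gt y t) 0 x)
  with (RInt (fun y => Derive (fun s => g y s) t) 0 x)
  by (apply RInt_ext; intros y _; now apply is_derive_unique, Hd).
apply (is_derive_RInt_param (fun s y => g y s)).
- exists (mkposreal _ Hm); intros s Hs y _.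
  exists (gt y s); apply Hd, Hnear, Hs.
- intros y _.
  apply continuity_2d_pt_ext_loc with (f := fun s y => gt y s).
  + exists (mkposreal _ Hm); intros s v Hs _.
    symmetry; apply is_derive_unique, Hd, Hnear, Hs.
  + intros eps; destruct (Hgt y t eps) as [d H].
    exists d; intros s v Hs Hv; now apply H.
- apply filter_forall; intros s; now apply cont2_ex_RInt.
Qed.

(** Both orders of the endpoints are covered, because the upper limit of an integral is later moved
    in either direction. *)
Lemma RInt_abs_le (f : R -> R) (a b M : R) :
  (forall z, continuous f z) ->
  (forall z, Rmin a b <= z <= Rmax a b -> Rabs (f z) <= M) ->
  Rabs (RInt f a b) <= Rabs (b - a) * M.
Proof.
intros Hf HM.
assert (Hex : forall c d, ex_RInt f c d)
  by (intros; apply (ex_RInt_continuous (V := R_CompleteNormedModule)); intros; apply Hf).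
destruct (Rle_lt_dec a b) as [Hab | Hab].
- rewrite (Rabs_pos_eq (b - a)) by lra.
  apply abs_RInt_le_const; [lra | apply Hex |].
  intros z Hz; apply HM; rewrite Rmin_left, Rmax_right; lra.
- rewrite <- (opp_RInt_swap f b a (Hex b a)).
  change (opp (RInt f b a)) with (- RInt f b a).
  rewrite Rabs_Ropp, (Rabs_left (b - a)) by lra.
  replace (- (b - a)) with (a - b) by ring.
  apply abs_RInt_le_const; [lra | apply Hex |].
  intros z Hz; apply HM; rewrite Rmin_right, Rmax_left; lra.
Qed.

(** The increment splits into the integral from 0 to [x] of the change of [g] in time, small by
    uniform continuity, and the integral over the short segment from [x] to [y], on which [g] is
    bounded by [M]. Each part costs at most [eps / 2]. *)
Lemma cont2_RInt (g : R -> R -> R) :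
  cont2 g -> cont2 (fun x t => RInt (fun y => g y t) 0 x).
Proof.
intros Hg x t eps.
assert (Hx := Rabs_pos x).
assert (He : 0 < eps / 2 / (Rabs x + 1))
  by (apply Rdiv_lt_0_compat; destruct eps; simpl; lra).
destruct (uniform_continuity_2d_1d g (Rmin 0 x) (Rmax 0 x) t (fun y _ => Hg y t)
            (mkposreal _ He)) as [d1 H1].
destruct (Hg x t (mkposreal 1 Rlt_0_1)) as [d2 H2]; simpl in H1, H2.
set (M := Rabs (g x t) + 1).
assert (HM : 0 < M) by (unfold M; assert (A := Rabs_pos (g x t)); lra).
assert (Hd3 : 0 < eps / 2 / M) by (apply Rdiv_lt_0_compat; destruct eps; simpl; lra).
assert (Hd : 0 < Rmin d1 (Rmin d2 (eps / 2 / M)))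
  by (repeat apply Rmin_pos; try apply cond_pos; exact Hd3).
exists (mkposreal _ Hd); simpl; intros y s Hy Hs.
assert (L1 := Rmin_l d1 (Rmin d2 (eps / 2 / M))).
assert (L2 := Rmin_r d1 (Rmin d2 (eps / 2 / M))).
assert (L3 := Rmin_l d2 (eps / 2 / M)); assert (L4 := Rmin_r d2 (eps / 2 / M)).
assert (E : RInt (fun z => g z s) 0 y - RInt (fun z => g z t) 0 x
            = RInt (fun z => g z s - g z t) 0 x + RInt (fun z => g z s) x y).
{ rewrite <- (RInt_Chasles (fun z => g z s) 0 x y) by now apply cont2_ex_RInt.
  rewrite (RInt_minus (V := R_CompleteNormedModule) (fun z => g z s) (fun z => g z t))
    by now apply cont2_ex_RInt.
  unfold plus, minus, opp; simpl; unfold plus, opp; simpl; ring. }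
rewrite E; eapply Rle_lt_trans; [apply Rabs_triang |].
assert (B1 : Rabs (RInt (fun z => g z s - g z t) 0 x)
             <= Rabs (x - 0) * (eps / 2 / (Rabs x + 1))).
{ apply RInt_abs_le.
  - intros z; apply (continuous_minus (V := R_NormedModule) (fun z => g z s) (fun z => g z t));
      now apply cont2_x.
  - intros z Hz; left; apply H1; try assumption.
    + destruct d1; simpl in *; lra.
    + apply Rabs_def2 in Hs; lra.
    + rewrite Rminus_diag, Rabs_R0; apply cond_pos. }
assert (B2 : Rabs (RInt (fun z => g z s) x y) <= Rabs (y - x) * M).
{ apply RInt_abs_le; [intro; now apply cont2_x |].
  intros z Hz.
  assert (Hzx : Rabs (z - x) < d2).
  { eapply Rle_lt_trans; [| eapply Rlt_le_trans; [exact Hy | lra]].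
    revert Hz; unfold Rmin, Rmax, Rabs; repeat destruct Rle_dec;
      repeat destruct Rcase_abs; lra. }
  specialize (H2 z s Hzx ltac:(lra)).
  unfold M; revert H2; unfold Rabs; repeat destruct Rcase_abs; lra. }
rewrite Rminus_0_r in B1.
assert (C1 : Rabs x * (eps / 2 / (Rabs x + 1)) <= eps / 2).
{ replace (eps / 2) with ((Rabs x + 1) * (eps / 2 / (Rabs x + 1))) at 2 by (field; lra).
  apply Rmult_le_compat_r; lra. }
assert (C2 : Rabs (y - x) * M < eps / 2).
{ replace (eps / 2) with (eps / 2 / M * M) by (field; lra).
  apply Rmult_lt_compat_r; lra. }
lra.
Qed.

(** * Comparison of the integrated momentum with a barrier *)

(* The shift [ka > 0] keeps the weight [r + ka] positive even at a vacuum, so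
   that no lower bound on the density is needed. *)
Lemma barrier_contradiction (mu T t1 lam ka : R)
    (r rx rt u ux uxx ut p px z zx zt : R -> R -> R) :
  0 < mu -> 0 < t1 < T -> 0 < lam < 1 -> 0 < ka ->
  cont2 r -> cont2 rt -> cont2 u -> cont2 ux -> cont2 ut -> cont2 p ->
  cont2 z -> cont2 zx -> cont2 zt ->
  (forall x t, 0 < x < 1 -> 0 < t < T ->
     is_derive (fun y => r y t) x (rx x t) /\ is_derive (fun y => u y t) x (ux x t) /\
     is_derive (fun y => ux y t) x (uxx x t) /\ is_derive (fun y => p y t) x (px x t) /\
     is_derive (fun y => z y t) x (zx x t)) ->
  (forall x t, 0 < t < T ->
     is_derive (fun s => r x s) t (rt x t) /\ is_derive (fun s => u x s) t (ut x t) /\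
     is_derive (fun s => z x s) t (zt x t)) ->
  (forall x t, 0 < x < 1 -> 0 < t < T -> 0 <= r x t /\ 0 <= p x t) ->
  (forall x, 0 < x < lam -> 0 <= r x 0) ->
  (forall x t, 0 < x < 1 -> 0 < t < T ->
     rt x t + (rx x t * u x t + r x t * ux x t) = 0 /\
     (rt x t * u x t + r x t * ut x t)
       + (rx x t * (u x t)^2 + 2 * r x t * u x t * ux x t + px x t) = mu * uxx x t) ->
  (forall t, 0 < t < T -> r 0 t = 0 /\ u 0 t = 0 /\ ux 0 t = 0 /\ p 0 t = 0) ->
  (forall x, 0 < x < lam -> u x 0 <= z x 0) ->
  (forall t, 0 <= t <= t1 -> RInt (fun y => (r y t + ka) * (u y t - z y t)) 0 lam <= 0) ->
  (forall x t, 0 < x < lam -> 0 < t <= t1 ->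
     mu * zx x t + RInt (fun y => ka * ut y t - (r y t + ka) * zt y t
                                  - r y t * u y t * zx y t) 0 x < 0) ->
  z 0 t1 < 0 -> False.
Proof.
intros Hmu Ht1 Hlam Hka Cr Crt Cu Cux Cut Cp Cz Czx Czt Dx Dt Hpos Hr0 Heq Hbc
  Hinit Hlamb Hsup Hz0.
set (g y t := (r y t + ka) * (u y t - z y t)).
set (gt y t := rt y t * (u y t - z y t) + (r y t + ka) * (ut y t - zt y t)).
set (h y t := ka * ut y t - (r y t + ka) * zt y t - r y t * u y t * zx y t).
(* These satisfy [gt = F_x + h]. The momentum equation makes [(r u)_t] the [x]-derivative of
   [mu ux - p - r u^2]; by the continuity equation [- rt z = (r u)_x z = (r u z)_x - r u zx], which
   gives the last term of the flux [F] and the last term of the source [h]. *)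
set (F y t := mu * ux y t - p y t - r y t * u y t * u y t + r y t * u y t * z y t).
assert (Cg : cont2 g) by (unfold g; cont2_tac).
assert (Cgt : cont2 gt) by (unfold gt; cont2_tac).
assert (Ch : cont2 h) by (unfold h; cont2_tac).
assert (CF : cont2 F) by (unfold F; cont2_tac).
assert (Dg : forall y s, 0 < s < T -> is_derive (fun s => g y s) s (gt y s)).
{ intros y s Hs; destruct (Dt y s Hs) as [D1 [D2 D3]]; unfold g, gt.
  auto_derive.
  - repeat split; eexists; eassumption.
  - rewrite (is_derive_unique (fun s : R => r y s) _ _ D1),
      (is_derive_unique (fun s : R => u y s) _ _ D2),
      (is_derive_unique (fun s : R => z y s) _ _ D3); ring. }
assert (HDt : forall x t, 0 < x < 1 -> 0 < t < T ->
          RInt (fun y => gt y t) 0 x = F x t + RInt (fun y => h y t) 0 x).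
{ intros x t Hx Ht.
  (* The difference of the two sides has zero derivative in the interior and is continuous up to
     [x = 0], where it vanishes because the boundary conditions give [F 0 t = 0]. *)
  destruct (MVT_gen (fun x => RInt (fun y => gt y t - h y t) 0 x - F x t) 0 x (fun _ => 0))
    as [c [_ Hc]].
  - rewrite Rmin_left, Rmax_right by lra; intros y Hy.
    destruct (Dx y t) as [D1 [D2 [D3 [D4 D5]]]]; [lra | lra |].
    destruct (Heq y t) as [E1 E2]; [lra | lra |].
    assert (DF : is_derive (fun x => F x t) y
      (mu * uxx y t - px y t - (rx y t * (u y t)^2 + 2 * r y t * u y t * ux y t)
       + ((rx y t * u y t + r y t * ux y t) * z y t + r y t * u y t * zx y t))).
    { unfold F; auto_derive.
      - repeat split; eexists; eassumption.
      - rewrite (is_derive_unique (fun x : R => ux x t) _ _ D3),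
          (is_derive_unique (fun x : R => p x t) _ _ D4),
          (is_derive_unique (fun x : R => r x t) _ _ D1),
          (is_derive_unique (fun x : R => u x t) _ _ D2),
          (is_derive_unique (fun x : R => z x t) _ _ D5); ring. }
    assert (DI := RInt_is_derive_bound (fun y t => gt y t - h y t) y t
              (cont2_minus _ _ Cgt Ch)).
    assert (D := is_derive_minus _ _ _ _ _ DI DF).
    eapply is_derive_ext; [| replace 0 with
      (minus (gt y t - h y t) (mu * uxx y t - px y t - (rx y t * (u y t)^2 + 2 * r y t * u y t * ux y t)
       + ((rx y t * u y t + r y t * ux y t) * z y t + r y t * u y t * zx y t))); [exact D |]].
    + reflexivity.
    + unfold minus, plus, opp; simpl; unfold gt, h.
      rewrite <- E2. replace (rx y t * u y t + r y t * ux y t) with (- rt y t) by lra.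
      ring.
  - intros y _; apply continuity_pt_filterlim.
    apply (cont2_x (fun x t => RInt (fun y => gt y t - h y t) 0 x - F x t)).
    apply cont2_minus; [apply (cont2_RInt (fun y t => gt y t - h y t)) |]; cont2_tac.
  - rewrite RInt_point in Hc.
    assert (HF0 : F 0 t = 0).
    { unfold F; destruct (Hbc t Ht) as [-> [-> [-> ->]]]; ring. }
    rewrite HF0 in Hc.
    rewrite (RInt_minus (V := R_CompleteNormedModule) (fun y => gt y t) (fun y => h y t))
      in Hc by now apply cont2_ex_RInt.
    unfold minus, plus, opp, zero in Hc; simpl in Hc; lra. }
destruct (interior_max (fun x t => RInt (fun y => g y t) 0 x) g
  (fun x t => RInt (fun y => gt y t) 0 x) lam t1)
  as [x0 [t0 [Hx0 [Ht0 [_ [Hgx [Hgt Hm]]]]]]].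
- lra.
- lra.
- now apply cont2_RInt.
- intros x t Hx Ht; split; [now apply RInt_is_derive_bound |].
  apply RInt_is_derive_param with (T := T); (assumption || lra).
- intros x Hx.
  replace 0 with (RInt (fun _ => 0) 0 x) at 2
    by (rewrite RInt_const; unfold scal; simpl; unfold mult; simpl; ring).
  apply RInt_le; [lra | now apply cont2_ex_RInt | apply ex_RInt_const |].
  intros y Hy; unfold g.
  specialize (Hr0 y ltac:(lra)); specialize (Hinit y ltac:(lra)); nra.
- intros t Ht; split; [rewrite RInt_point; apply Rle_refl | now apply Hlamb].
(* The integral is positive somewhere: at time [t1] the boundary value [u = 0] exceeds [z], so
   [u - z > 0] for small [x], and the weight is positive. *)
- destruct (cont2_x (fun x t => u x t - z x t) 0 t1 (cont2_minus _ _ Cu Cz)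
     (fun v => 0 < v)) as [d Hd].
  { apply (open_gt 0). destruct (Hbc t1) as [_ [-> _]]; lra. }
  assert (Hmin : 0 < Rmin (d / 2) lam)
    by (apply Rmin_pos; [destruct d; simpl; lra | lra]).
  assert (Hl := Rmin_l (d / 2) lam); assert (Hr := Rmin_r (d / 2) lam).
  exists (Rmin (d / 2) lam), t1; repeat split; try lra.
  apply RInt_gt_0; [exact Hmin | | intros; now apply cont2_x].
  intros y Hy; apply Rmult_lt_0_compat.
  + destruct (Hpos y t1); lra.
  + apply Hd; change (Rabs (y - 0) < d).
    rewrite Rminus_0_r, Rabs_pos_eq; destruct d; simpl in *; lra.
- destruct (Hpos x0 t0) as [Hr Hp]; [lra | lra |].
  (* At the maximum the integrand vanishes, so [u = z] and the flux reduces to [mu ux - p]. The time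
     derivative is nonnegative, so [Hsup] yields [mu (ux - zx) > p >= 0]. *)
  assert (Hw : u x0 t0 - z x0 t0 = 0) by (unfold g in Hgx; nra).
  rewrite HDt in Hgt by lra.
  assert (HF : F x0 t0 = mu * ux x0 t0 - p x0 t0).
  { unfold F; replace (u x0 t0) with (z x0 t0) by lra; ring. }
  specialize (Hsup x0 t0 Hx0 Ht0).
  change (mu * zx x0 t0 + RInt (fun y => h y t0) 0 x0 < 0) in Hsup.
  assert (Hwx : 0 < ux x0 t0 - zx x0 t0) by nra.
  destruct (Dx x0 t0) as [_ [D2 [_ [_ D5]]]]; [lra | lra |].
  assert (D := is_derive_minus _ _ _ _ _ D2 D5).
  apply is_derive_Reals in D.
  destruct (D _ Hwx) as [d Hd].
  assert (Hmin : 0 < Rmin (d / 2) (lam - x0))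
    by (apply Rmin_pos; [destruct d; simpl; lra | lra]).
  assert (Hl := Rmin_l (d / 2) (lam - x0)); assert (Hrr := Rmin_r (d / 2) (lam - x0)).
  set (k := Rmin (d / 2) (lam - x0)) in *.
  specialize (Hm (x0 + k) ltac:(lra)).
  rewrite <- (RInt_Chasles (fun y => g y t0) 0 x0 (x0 + k)) in Hm
    by now apply cont2_ex_RInt.
  (* As [u - z] vanishes at [x0] with positive slope, the integral still grows to the right of [x0],
     contradicting maximality. *)
  assert (0 < RInt (fun y => g y t0) x0 (x0 + k)).
  { apply RInt_gt_0; [lra | | intros; now apply cont2_x].
    intros y Hy; apply Rmult_lt_0_compat.
    - destruct (Hpos y t0); lra.
    - specialize (Hd (y - x0) ltac:(lra)).
      rewrite Rabs_pos_eq in Hd by lra.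
      specialize (Hd ltac:(destruct d; simpl in *; lra)).
      replace (x0 + (y - x0)) with y in Hd by ring.
      unfold minus, plus, opp in Hd; simpl in Hd.
      apply Rabs_def2 in Hd; destruct Hd as [_ Hd].
      assert (0 < (u y t0 + - z y t0 - (u x0 t0 + - z x0 t0)) / (y - x0)) by lra.
      assert (Hq : (u y t0 + - z y t0 - (u x0 t0 + - z x0 t0))
         = (u y t0 + - z y t0 - (u x0 t0 + - z x0 t0)) / (y - x0) * (y - x0))
        by (field; lra).
      assert (0 < (u y t0 + - z y t0 - (u x0 t0 + - z x0 t0)) / (y - x0) * (y - x0))
        by (apply Rmult_lt_0_compat; lra).
      lra. }
  unfold plus in Hm; simpl in Hm; lra.
Qed.

(** * The explicit barrier near the left end *)

(** By continuity [f] stays below [f lam / 2] on a short interval to the left of [lam], and this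
    piece makes the integral strictly negative. *)
Lemma RInt_neg (f : R -> R) (lam : R) :
  0 < lam -> (forall y, continuous f y) -> (forall y, 0 < y < lam -> f y <= 0) ->
  f lam < 0 -> RInt f 0 lam < 0.
Proof.
intros Hlam Hc Hle Hlt.
assert (Hex : forall a b, ex_RInt f a b)
  by (intros; apply (ex_RInt_continuous (V := R_CompleteNormedModule)); intros; apply Hc).
destruct (Hc lam (fun v => v < f lam / 2)) as [d Hd]; [apply (open_lt (f lam / 2)); lra |].
assert (Hmin : 0 < Rmin (d / 2) lam)
  by (apply Rmin_pos; [destruct d; simpl; lra | lra]).
assert (Hl := Rmin_l (d / 2) lam); assert (Hr := Rmin_r (d / 2) lam).
set (k := Rmin (d / 2) lam) in *.
rewrite <- (RInt_Chasles f 0 (lam - k) lam) by apply Hex.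
assert (H1 : RInt f 0 (lam - k) <= RInt (fun _ => 0) 0 (lam - k)).
{ apply RInt_le; [lra | apply Hex | apply ex_RInt_const |].
  intros y Hy; apply Hle; lra. }
assert (H2 : RInt f (lam - k) lam <= RInt (fun _ => f lam / 2) (lam - k) lam).
{ apply RInt_le; [lra | apply Hex | apply ex_RInt_const |].
  intros y Hy; left; apply Hd; change (Rabs (y - lam) < d).
  rewrite Rabs_left; destruct d; simpl in *; lra. }
rewrite RInt_const in H1, H2.
unfold scal in H1, H2; simpl in H1, H2; unfold mult in H1, H2; simpl in H1, H2.
unfold plus; simpl; nra.
Qed.

(** The total momentum in [(0,lam)] is negative at time 0 and stays below some [- c] up to a time
    [t1], which leaves room for a small barrier at [x = lam]. The parameters of the barrier are
    fixed in the order [al], [be], [eps], [ka]. *)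
Lemma left_contradiction (mu T lam : R)
    (r rx rt u ux uxx ut p px : R -> R -> R) :
  0 < mu -> 0 < T -> 0 < lam < 1 ->
  cont2 r -> cont2 rt -> cont2 u -> cont2 ux -> cont2 ut -> cont2 p ->
  (forall x t, 0 < x < 1 -> 0 < t < T ->
     is_derive (fun y => r y t) x (rx x t) /\ is_derive (fun y => u y t) x (ux x t) /\
     is_derive (fun y => ux y t) x (uxx x t) /\ is_derive (fun y => p y t) x (px x t)) ->
  (forall x t, 0 < t < T ->
     is_derive (fun s => r x s) t (rt x t) /\ is_derive (fun s => u x s) t (ut x t)) ->
  (forall x t, 0 < x < 1 -> 0 <= t < T -> 0 <= r x t /\ 0 <= p x t) ->
  (forall x t, 0 < x < 1 -> 0 < t < T ->
     rt x t + (rx x t * u x t + r x t * ux x t) = 0 /\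
     (rt x t * u x t + r x t * ut x t)
       + (rx x t * (u x t)^2 + 2 * r x t * u x t * ux x t + px x t) = mu * uxx x t) ->
  (forall t, 0 < t < T -> r 0 t = 0 /\ u 0 t = 0 /\ ux 0 t = 0 /\ p 0 t = 0) ->
  (forall x, 0 < x < lam -> u x 0 <= 0) -> u lam 0 < 0 -> 0 < r lam 0 ->
  False.
Proof.
intros Hmu HT Hlam Cr Crt Cu Cux Cut Cp Dx Dt Hpos Heq Hbc Hinit Hulam Hrlam.
destruct (cont2_bounded r 1 T) as [R1 [HR1 BR]]; [lra | lra | assumption |].
destruct (cont2_bounded u 1 T) as [U [HU BU]]; [lra | lra | assumption |].
destruct (cont2_bounded ut 1 T) as [A [HA BA]]; [lra | lra | assumption |].
set (Rm := R1 + 1); assert (HRm : 0 < Rm) by (unfold Rm; lra).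
set (P := fun t => RInt (fun y => r y t * u y t) 0 lam).
assert (Cru : cont2 (fun y t => r y t * u y t)) by cont2_tac.
assert (HP0 : P 0 < 0).
{ apply RInt_neg; [lra | intro y; now apply (cont2_x (fun y t => r y t * u y t)) | |].
  - intros y Hy; specialize (Hinit y Hy).
    destruct (Hpos y 0) as [Hr _]; [lra | lra |]; nra.
  - nra. }
set (c := - P 0 / 2); assert (Hc : 0 < c) by (unfold c; lra).
assert (Ht1 : exists t1, 0 < t1 < T /\ forall t, 0 <= t <= t1 -> P t <= - c).
{ destruct (cont2_t _ lam 0 (cont2_RInt _ Cru) (fun v => v < - c)) as [d Hd].
  { apply (open_lt (- c)); fold (P 0); unfold c; lra. }
  assert (Hmin : 0 < Rmin (d / 2) (T / 2))
    by (apply Rmin_pos; [destruct d; simpl; lra | lra]).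
  assert (Hl := Rmin_l (d / 2) (T / 2)); assert (Hr := Rmin_r (d / 2) (T / 2)).
  exists (Rmin (d / 2) (T / 2)); split; [lra |].
  intros t Ht; left; apply Hd; change (Rabs (t - 0) < d).
  rewrite Rminus_0_r, Rabs_pos_eq; destruct d; simpl in *; lra. }
destruct Ht1 as [t1 [Ht1 HP]].
(* Two demands fix [al] and [be]. Having [z 0 t1 < 0] means [al * lam < be * t1]; here
   [be * t1 = al * (U * t1 + 1)] and [lam < 1]. The supersolution property asks that [Rm * be] and
   [Rm * U * al] each be at most [mu * al ^ 2 / 4]. *)
set (al := 4 * Rm * (U + / t1) / mu).
assert (Hit1 : 0 < / t1) by (apply Rinv_0_lt_compat; lra).
assert (Hal : 0 < al) by (unfold al; apply Rdiv_lt_0_compat; [repeat apply Rmult_lt_0_compat |]; lra).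
assert (Emual : mu * al = 4 * Rm * (U + / t1)) by (unfold al; field; lra).
set (be := mu * al ^ 2 / (4 * Rm)).
assert (Hbe : 0 < be) by (unfold be; apply Rdiv_lt_0_compat;
      [apply Rmult_lt_0_compat; [| apply pow_lt] |]; lra).
assert (EbeR : Rm * be = mu * al ^ 2 / 4) by (unfold be; field; lra).
assert (Hbet : al * lam < be * t1).
{ replace (be * t1) with (al * (U * t1 + 1)).
  - apply Rmult_lt_compat_l; nra.
  - unfold be; replace (mu * al ^ 2) with (mu * al * al) by ring.
    rewrite Emual; field; lra. }
assert (Hrate : Rm * (be + U * al) <= mu * al * al / 2).
{ assert (Rm * U * al <= mu * al * al / 4).
  { rewrite Emual; assert (0 < Rm * al) by nra; nra. }
  nra. }
clearbody be al.
(* [K] makes the barrier nonnegative on [(0,lam)] at time 0, [Em] bounds the exponential up to [t1],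
   and [eps] limits the contribution of the barrier at [x = lam] to [c / 4]. *)
set (K := exp (al * lam)).
set (Em := exp (al * lam + be * t1)); assert (HEm : 0 < Em) by apply exp_pos.
set (eps := c / (4 * Rm * Em)).
assert (Heps : 0 < eps) by (unfold eps; apply Rdiv_lt_0_compat; [| repeat apply Rmult_lt_0_compat]; lra).
assert (Eeps : eps * Rm * Em = c / 4) by (unfold eps; field; lra).
clearbody eps.
(* The shift comes last because it depends on [eps]. Its bounds give [r + ka <= Rm], an error of at
   most [c / 4] at [x = lam], and a term in [ut] that diffusion absorbs. *)
assert (Hka : exists ka, 0 < ka /\ ka <= 1 /\ ka * U <= c / 4 /\ ka * A <= eps * mu * al / 4).
{ assert (H1 : 0 < c / 4 / U) by (apply Rdiv_lt_0_compat; lra).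
  assert (H0 : 0 < eps * mu * al) by (repeat apply Rmult_lt_0_compat; lra).
  assert (H2 : 0 < eps * mu * al / 4 / A) by (apply Rdiv_lt_0_compat; lra).
  set (q := Rmin (c / 4 / U) (eps * mu * al / 4 / A)).
  assert (Hq1 : q <= c / 4 / U) by apply Rmin_l.
  assert (Hq2 : q <= eps * mu * al / 4 / A) by apply Rmin_r.
  assert (Hq : 0 < q) by now apply Rmin_pos.
  assert (Hk0 : 0 < Rmin 1 q) by (apply Rmin_pos; lra).
  assert (Hk1 := Rmin_l 1 q); assert (Hk2 := Rmin_r 1 q).
  exists (Rmin 1 q); repeat split; try lra.
  - replace (c / 4) with (c / 4 / U * U) by (field; lra).
    apply Rmult_le_compat_r; lra.
  - replace (eps * mu * al / 4) with (eps * mu * al / 4 / A * A) by (field; lra).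
    apply Rmult_le_compat_r; lra. }
destruct Hka as [ka [Hka [Hka1 [HkaU HkaA]]]].
set (E x t := exp (al * x + be * t)).
assert (HE : forall x t, 0 < E x t) by (intros; apply exp_pos).
assert (CE : cont2 E) by (unfold E; cont2_tac).
apply (barrier_contradiction mu T t1 lam ka r rx rt u ux uxx ut p px
  (fun x t => eps * (K - E x t)) (fun x t => - eps * al * E x t)
  (fun x t => - eps * be * E x t)); try assumption; try solve [cont2_tac].
- intros x t Hx Ht; destruct (Dx x t Hx Ht) as [D1 [D2 [D3 D4]]].
  do 4 (split; [assumption |]).
  unfold E; auto_derive; [exact I | ring].
- intros x t Ht; destruct (Dt x t Ht) as [D1 D2].
  do 2 (split; [assumption |]).
  unfold E; auto_derive; [exact I | ring].
- intros x t Hx Ht; apply Hpos; lra.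
- intros x Hx; apply Hpos; lra.
- intros x Hx; specialize (Hinit x Hx).
  assert (E x 0 <= K).
  { left; apply exp_increasing; nra. }
  nra.
- intros t Ht.
  assert (Hle : RInt (fun y => (r y t + ka) * (u y t - eps * (K - E y t))) 0 lam
     <= RInt (fun y => r y t * u y t + (ka * U + eps * Rm * Em)) 0 lam).
  { apply RInt_le; [lra | | |].
    - apply (cont2_ex_RInt (fun y t => (r y t + ka) * (u y t - eps * (K - E y t)))).
      cont2_tac.
    - apply (cont2_ex_RInt (fun y t => r y t * u y t + (ka * U + eps * Rm * Em))).
      cont2_tac.
    - intros y Hy; destruct (Hpos y t) as [Hr _]; [lra | lra |].
      specialize (BR y t ltac:(lra) ltac:(lra)); specialize (BU y t ltac:(lra) ltac:(lra)).
      assert (HEy : E y t <= Em).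
      { destruct (Rle_lt_dec t1 t).
        - left; apply exp_increasing; nra.
        - left; apply exp_increasing; nra. }
      assert (HK : 0 < K) by apply exp_pos.
      assert (r y t <= R1) by (unfold Rabs in BR; destruct Rcase_abs; lra).
      assert (u y t <= U) by (unfold Rabs in BU; destruct Rcase_abs; lra).
      assert (ka * u y t <= ka * U) by (apply Rmult_le_compat_l; lra).
      assert (Hz : - (eps * (K - E y t)) <= eps * Em) by nra.
      assert ((r y t + ka) * (- (eps * (K - E y t))) <= (r y t + ka) * (eps * Em))
        by (apply Rmult_le_compat_l; lra).
      assert ((r y t + ka) * (eps * Em) <= Rm * (eps * Em))
        by (apply Rmult_le_compat_r; [nra | unfold Rm; lra]).
      lra. }
  rewrite (RInt_plus (V := R_CompleteNormedModule) (fun y => r y t * u y t)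
    (fun _ => ka * U + eps * Rm * Em)), RInt_const in Hle.
  2: now apply (cont2_ex_RInt (fun y t => r y t * u y t)).
  2: apply ex_RInt_const.
  unfold plus, scal in Hle; simpl in Hle; unfold mult in Hle; simpl in Hle.
  specialize (HP t Ht); unfold P in HP.
  assert ((lam - 0) * (ka * U + eps * Rm * Em) <= c).
  { assert (0 <= ka * U) by nra. nra. }
  lra.
- intros x t Hx Ht.
  (* [G] is a primitive of an upper bound for the source. Its exponential part integrates to half of
     [- mu * zx], up to a negative term at 0; the other half exceeds [ka * A * x] because
     [E x t > 1]. *)
  set (G y := ka * A * y + eps * mu * al / 2 * E y t).
  assert (HG : is_RInt (fun y => ka * A + eps * mu * al / 2 * (al * E y t)) 0 x
                 (minus (G x) (G 0))).
  { apply (is_RInt_derive (V := R_CompleteNormedModule) G).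
    - intros y _; unfold G, E; auto_derive; [exact I | ring].
    - intros y _.
      apply (cont2_x (fun y t => ka * A + eps * mu * al / 2 * (al * E y t))); cont2_tac. }
  assert (Hle : RInt (fun y => ka * ut y t - (r y t + ka) * (- eps * be * E y t)
                         - r y t * u y t * (- eps * al * E y t)) 0 x
     <= RInt (fun y => ka * A + eps * mu * al / 2 * (al * E y t)) 0 x).
  { apply RInt_le; [lra | | eexists; exact HG |].
    - apply (cont2_ex_RInt (fun y t => ka * ut y t - (r y t + ka) * (- eps * be * E y t)
                         - r y t * u y t * (- eps * al * E y t))).
      cont2_tac.
    - intros y Hy; destruct (Hpos y t) as [Hr _]; [lra | lra |].
      specialize (BR y t ltac:(lra) ltac:(lra)); specialize (BU y t ltac:(lra) ltac:(lra)).
      specialize (BA y t ltac:(lra) ltac:(lra)).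
      assert (r y t <= R1) by (unfold Rabs in BR; destruct Rcase_abs; lra).
      assert (u y t <= U) by (unfold Rabs in BU; destruct Rcase_abs; lra).
      assert (ut y t <= A) by (unfold Rabs in BA; destruct Rcase_abs; lra).
      assert (J1 : ka * ut y t <= ka * A) by (apply Rmult_le_compat_l; lra).
      assert (J2 : (r y t + ka) * be <= Rm * be)
        by (apply Rmult_le_compat_r; unfold Rm; lra).
      assert (J3 : r y t * u y t <= Rm * U).
      { apply Rle_trans with (r y t * U); [apply Rmult_le_compat_l; lra |].
        apply Rmult_le_compat_r; unfold Rm; lra. }
      assert (J4 : r y t * u y t * al <= Rm * U * al) by (apply Rmult_le_compat_r; lra).
      assert (J5 : 0 < eps * E y t) by (apply Rmult_lt_0_compat; [lra | apply HE]).
      assert (J6 : ((r y t + ka) * be + r y t * u y t * al) * (eps * E y t)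
                   <= mu * al * al / 2 * (eps * E y t))
        by (apply Rmult_le_compat_r; lra).
      lra. }
  rewrite (is_RInt_unique _ _ _ _ HG) in Hle.
  unfold minus, plus, opp in Hle; simpl in Hle; unfold G in Hle.
  assert (HE0 := HE 0 t).
  assert (HEx : 1 < E x t).
  { rewrite <- exp_0; apply exp_increasing.
    assert (0 < al * x) by nra; assert (0 < be * t) by nra; lra. }
  assert (Hma : 0 < eps * mu * al) by (repeat apply Rmult_lt_0_compat; lra).
  assert (ka * A * x <= eps * mu * al / 4).
  { assert (0 < ka * A) by nra; nra. }
  assert (eps * mu * al < eps * mu * al * E x t) by nra.
  assert (0 < eps * mu * al * E 0 t) by nra.
  lra.
- assert (K < E 0 t1) by (apply exp_increasing; lra).
  nra.
Qed.

(** * From a classical solution to the contradiction at the left end *)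

(** Boundary conditions hold for [t > 0] and initial data for interior [x]; continuity supplies the
    corners. A nonzero corner value, taken as its own tolerance, would satisfy
    [|f x 0| < |f x 0|]. *)
Lemma cont2_zero_init (f : R -> R -> R) (x T : R) :
  0 < T -> cont2 f -> (forall t, 0 < t < T -> f x t = 0) -> f x 0 = 0.
Proof.
intros HT Hf H0.
destruct (Req_dec (f x 0) 0) as [|Hne]; [assumption | exfalso].
destruct (Hf x 0 (mkposreal _ (Rabs_pos_lt _ Hne))) as [d Hd]; simpl in Hd.
assert (Hmin : 0 < Rmin (d / 2) (T / 2))
  by (apply Rmin_pos; [destruct d; simpl; lra | lra]).
assert (Hl := Rmin_l (d / 2) (T / 2)); assert (Hr := Rmin_r (d / 2) (T / 2)).
specialize (Hd x (Rmin (d / 2) (T / 2))).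
rewrite (H0 (Rmin (d / 2) (T / 2))) in Hd by lra.
rewrite !Rminus_0_l, Rabs_Ropp in Hd.
apply (Rlt_irrefl (Rabs (f x 0))), Hd.
- rewrite Rminus_diag, Rabs_R0; apply cond_pos.
- rewrite Rminus_0_r, Rabs_pos_eq; destruct d; simpl in *; lra.
Qed.

(** The maximum principle for transport provides the signs of density and pressure; the clamped
    extensions of the solution then meet the conditions of [left_contradiction]. *)
Lemma no_solution_left (mu gamma T lam : R) (rho0 u0 e0 : R -> R)
    (rho u e : R -> R -> R) :
  0 < mu -> 1 < gamma -> 0 < T -> 0 < lam < 1 ->
  (forall x, 0 < x < 1 -> 0 < rho0 x) ->
  (forall x, 0 < x < 1 -> 0 <= e0 x) ->
  u0 lam < 0 -> (forall x, 0 < x < lam -> u0 x <= 0) ->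
  ~ is_C21_solution mu gamma T rho0 u0 e0 rho u e.
Proof.
intros Hmu Hgamma HT Hlam Hrho0 He0 Hulam Hu0
  (rx & rxx & rt & ux & uxx & ut & ex & exx & et & Hrho & Hu & He & Heq & Hini & Hbc).
destruct Hrho as (Cr & Crx & _ & Crt & Drx & _ & Drt).
destruct Hu as (Cu & Cux & Cuxx & Cut & Dux & Duxx & Dut).
destruct He as (Ce & Cex & _ & Cet & Dex & _ & Det).
assert (HT0 : 0 <= T) by lra.
apply (ext_cont2 T) in Cr, Crx, Crt, Cu, Cux, Cuxx, Cut, Ce, Cex, Cet; try assumption.
assert (Hb : forall t, 0 < t < T ->
  ext T rho 0 t = 0 /\ ext T rho 1 t = 0 /\ ext T u 0 t = 0 /\ ext T ux 0 t = 0).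
{ intros t Ht; rewrite !ext_in by lra; destruct (Hbc t) as (? & ? & ? & ? & ? & ?);
    [lra | tauto]. }
assert (HB0 : forall t, 0 <= t < T -> ext T rho 0 t = 0 /\ ext T rho 1 t = 0).
{ intros t Ht; destruct (Req_dec t 0) as [-> |]; [split | split; apply Hb; lra].
  - apply (cont2_zero_init _ 0 T); try assumption; intros s Hs; now apply Hb.
  - apply (cont2_zero_init _ 1 T); try assumption; intros s Hs; now apply Hb. }
assert (Hi : forall x, 0 < x < 1 ->
  ext T rho x 0 = rho0 x /\ ext T u x 0 = u0 x /\ ext T e x 0 = e0 x)
  by (intros x Hx; rewrite !ext_in by lra; now apply Hini).
destruct (cont2_bounded (ext T ux) 1 T) as [M [HM BM]]; try assumption; [lra |].
assert (Hrpos : forall x t, 0 <= x <= 1 -> 0 <= t < T -> 0 <= ext T rho x t).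
{ apply (transport_nonneg T M (ext T rho) (ext T rx) (ext T rt) (ext T u) (ext T ux));
    try assumption.
  - intros x t Hx Ht; split; [apply ext_is_derive_x | apply ext_is_derive_t];
      (assumption || lra).
  - intros x t Hx Ht; apply BM; lra.
  - intros x t Hx Ht; rewrite !ext_in by lra.
    destruct (Heq x t) as [E _]; lra.
  - intros x Hx; destruct (Req_dec x 0) as [-> |]; [destruct (HB0 0); lra |].
    destruct (Req_dec x 1) as [-> |]; [destruct (HB0 0); lra |].
    destruct (Hi x) as [-> _]; [lra | left; apply Hrho0; lra].
  - intros t Ht; destruct (HB0 t Ht); lra. }
(* The energy equation is a transport equation for the product [rho e]: convection and pressure work
   combine into the coefficient [gamma ux], and the heating [mu ux^2] is a nonnegative source. The
   product vanishes on the boundary together with [rho]. *)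
assert (Hpipos : forall x t, 0 <= x <= 1 -> 0 <= t < T -> 0 <= ext T rho x t * ext T e x t).
{ apply (transport_nonneg T (gamma * M) (fun x t => ext T rho x t * ext T e x t)
    (fun x t => ext T rx x t * ext T e x t + ext T rho x t * ext T ex x t)
    (fun x t => ext T rt x t * ext T e x t + ext T rho x t * ext T et x t)
    (ext T u) (fun x t => gamma * ext T ux x t)).
  - cont2_tac.
  - intros x t Hx Ht; split.
    + apply (is_derive_mult (fun y => ext T rho y t) (fun y => ext T e y t));
        [| | intros; apply Rmult_comm]; apply ext_is_derive_x; (assumption || lra).
    + apply (is_derive_mult (fun s => ext T rho x s) (fun s => ext T e x s));
        [| | intros; apply Rmult_comm]; apply ext_is_derive_t; (assumption || lra).
  - intros x t Hx Ht; rewrite Rabs_mult, (Rabs_pos_eq gamma) by lra.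
    apply Rmult_le_compat_l; [lra | apply BM; lra].
  - intros x t Hx Ht; rewrite !ext_in by lra.
    destruct (Heq x t) as [_ [_ E]]; [lra | lra |].
    assert (0 <= mu * ux x t ^ 2) by (apply Rmult_le_pos; [lra | apply pow2_ge_0]).
    rewrite <- E in H; lra.
  - intros x Hx; destruct (Req_dec x 0) as [-> |].
    { destruct (HB0 0) as [-> _]; lra. }
    destruct (Req_dec x 1) as [-> |].
    { destruct (HB0 0) as [_ ->]; lra. }
    destruct (Hi x) as [-> [_ ->]]; [lra |].
    specialize (Hrho0 x ltac:(lra)); specialize (He0 x ltac:(lra)); nra.
  - intros t Ht; destruct (HB0 t Ht) as [-> ->]; lra. }
apply (left_contradiction mu T lam (ext T rho) (ext T rx) (ext T rt) (ext T u) (ext T ux)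
  (ext T uxx) (ext T ut) (fun x t => (gamma - 1) * (ext T rho x t * ext T e x t))
  (fun x t => (gamma - 1) * (ext T rx x t * ext T e x t + ext T rho x t * ext T ex x t)));
  try assumption.
- cont2_tac.
- intros x t Hx Ht.
  assert (Hx' : 0 < x < 1) by lra; assert (Ht' : 0 <= t <= T) by lra.
  split; [now apply ext_is_derive_x |].
  split; [now apply ext_is_derive_x |].
  split; [now apply ext_is_derive_x |].
  apply (is_derive_scal (fun y => ext T rho y t * ext T e y t)).
  apply (is_derive_mult (fun y => ext T rho y t) (fun y => ext T e y t));
    [| | intros; apply Rmult_comm]; now apply ext_is_derive_x.
- intros x t Ht; split; now apply ext_is_derive_t.
- intros x t Hx Ht; split; [apply Hrpos; lra |].
  apply Rmult_le_pos; [lra | apply Hpipos; lra].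
- intros x t Hx Ht; rewrite !ext_in by lra.
  destruct (Heq x t) as [E1 [E2 _]]; [lra | lra |]; split; lra.
- intros t Ht; destruct (Hb t Ht) as [-> [_ [-> ->]]]; repeat split; ring.
- intros x Hx; destruct (Hi x) as [_ [-> _]]; [lra | now apply Hu0].
- destruct (Hi lam) as [_ [-> _]]; lra.
- destruct (Hi lam) as [-> _]; [lra | now apply Hrho0].
Qed.

(** * Reflection of solutions about the midpoint of the interval *)

Lemma cont_rect_opp (T : R) (g : R -> R -> R) :
  cont_rect T g -> cont_rect T (fun x t => - g x t).
Proof.
intros Hg x t Hxt eps Heps; destruct (Hg x t Hxt eps Heps) as [d [Hd H]].
exists d; split; [exact Hd |]; intros y s Hys Hy Hs.
replace (- g y s - - g x t) with (- (g y s - g x t)) by ring.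
rewrite Rabs_Ropp; now apply H.
Qed.

Lemma pdx_rect_opp (T : R) (g g' : R -> R -> R) :
  pdx_rect T g g' -> pdx_rect T (fun x t => - g x t) (fun x t => - g' x t).
Proof.
intros Hg x t Hxt eps Heps; destruct (Hg x t Hxt eps Heps) as [d [Hd H]].
exists d; split; [exact Hd |]; intros h Hh0 Hh Hx.
replace ((- g (x + h) t - - g x t) / h - - g' x t)
  with (- ((g (x + h) t - g x t) / h - g' x t)) by (field; exact Hh0).
rewrite Rabs_Ropp; now apply H.
Qed.

Lemma pdt_rect_opp (T : R) (g g' : R -> R -> R) :
  pdt_rect T g g' -> pdt_rect T (fun x t => - g x t) (fun x t => - g' x t).
Proof.
intros Hg x t Hxt eps Heps; destruct (Hg x t Hxt eps Heps) as [d [Hd H]].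
exists d; split; [exact Hd |]; intros h Hh0 Hh Ht.
replace ((- g x (t + h) - - g x t) / h - - g' x t)
  with (- ((g x (t + h) - g x t) / h - g' x t)) by (field; exact Hh0).
rewrite Rabs_Ropp; now apply H.
Qed.

Lemma C21_rect_opp (T : R) (f fx fxx ft : R -> R -> R) :
  C21_rect T f fx fxx ft ->
  C21_rect T (fun x t => - f x t) (fun x t => - fx x t) (fun x t => - fxx x t)
    (fun x t => - ft x t).
Proof.
intros (H1 & H2 & H3 & H4 & H5 & H6 & H7).
repeat split; auto using cont_rect_opp, pdx_rect_opp, pdt_rect_opp.
Qed.

Lemma in_rect_reflect (T x t : R) : in_rect T x t -> in_rect T (1 - x) t.
Proof. intros [Hx Ht]; split; lra. Qed.

Lemma cont_rect_reflect (T : R) (g : R -> R -> R) :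
  cont_rect T g -> cont_rect T (fun x t => g (1 - x) t).
Proof.
intros Hg x t Hxt eps Heps.
destruct (Hg (1 - x) t (in_rect_reflect _ _ _ Hxt) eps Heps) as [d [Hd H]].
exists d; split; [exact Hd |]; intros y s Hys Hy Hs.
apply H; [now apply in_rect_reflect | | exact Hs].
replace (1 - y - (1 - x)) with (- (y - x)) by ring; now rewrite Rabs_Ropp.
Qed.

Lemma pdx_rect_reflect (T : R) (g g' : R -> R -> R) :
  pdx_rect T g g' -> pdx_rect T (fun x t => g (1 - x) t) (fun x t => - g' (1 - x) t).
Proof.
intros Hg x t Hxt eps Heps.
destruct (Hg (1 - x) t (in_rect_reflect _ _ _ Hxt) eps Heps) as [d [Hd H]].
exists d; split; [exact Hd |]; intros h Hh0 Hh Hx.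
specialize (H (- h) ltac:(lra) ltac:(now rewrite Rabs_Ropp) ltac:(lra)).
replace (1 - (x + h)) with (1 - x + - h) by ring.
rewrite <- Rabs_Ropp.
replace (- ((g (1 - x + - h) t - g (1 - x) t) / h - - g' (1 - x) t))
  with ((g (1 - x + - h) t - g (1 - x) t) / - h - g' (1 - x) t) by (field; lra).
exact H.
Qed.

Lemma C21_rect_reflect (T : R) (f fx fxx ft : R -> R -> R) :
  C21_rect T f fx fxx ft ->
  C21_rect T (fun x t => f (1 - x) t) (fun x t => - fx (1 - x) t)
    (fun x t => fxx (1 - x) t) (fun x t => ft (1 - x) t).
Proof.
intros (H1 & H2 & H3 & H4 & H5 & H6 & H7).
repeat split; auto using cont_rect_reflect, pdx_rect_reflect.
- now apply (cont_rect_opp T (fun x t => fx (1 - x) t)), cont_rect_reflect.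
(* Differentiating [- fx (1 - x)] produces [- - fxx (1 - x)]; the double sign is removed under the
   quantifiers. *)
- assert (H := pdx_rect_opp _ _ _ (pdx_rect_reflect _ _ _ H6)).
  intros x t Hxt eps Heps; destruct (H x t Hxt eps Heps) as [d [Hd Hh]].
  exists d; split; [exact Hd |].
  intros h Hh0 Hhd Hx; specialize (Hh h Hh0 Hhd Hx).
  now rewrite Ropp_involutive in Hh.
- intros x t Hxt; exact (H7 (1 - x) t (in_rect_reflect _ _ _ Hxt)).
Qed.

(** Each [x]-derivative changes sign and so does [u]: the continuity and energy equations are
    unchanged, the momentum equation is multiplied by -1, and the two ends swap. *)
Lemma is_C21_solution_reflect (mu gamma T : R) (rho0 u0 e0 : R -> R)
    (rho u e : R -> R -> R) :
  is_C21_solution mu gamma T rho0 u0 e0 rho u e ->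
  is_C21_solution mu gamma T (fun x => rho0 (1 - x)) (fun x => - u0 (1 - x))
    (fun x => e0 (1 - x)) (fun x t => rho (1 - x) t) (fun x t => - u (1 - x) t)
    (fun x t => e (1 - x) t).
Proof.
intros (rx & rxx & rt & ux & uxx & ut & ex & exx & et & Hrho & Hu & He & Heq & Hini & Hbc).
(* The nine derivative functions are determined by unification with the three regularity proofs that
   follow. *)
do 9 eexists.
split; [apply C21_rect_reflect; exact Hrho |].
split; [apply (C21_rect_opp _ _ _ _ _ (C21_rect_reflect _ _ _ _ _ Hu)) |].
split; [apply C21_rect_reflect; exact He |].
split; [| split].
- intros x t Hx Ht; cbv zeta.
  destruct (Heq (1 - x) t) as [E1 [E2 E3]]; [lra | lra |].
  repeat split; lra.
- intros x Hx; destruct (Hini (1 - x)) as [-> [-> ->]]; [lra | repeat split].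
- intros t Ht; destruct (Hbc t Ht) as (B1 & B2 & B3 & B4 & B5 & B6).
  rewrite Rminus_0_r, Rminus_diag, B1, B2, B3, B4, B5, B6; repeat split; ring.
Qed.

Theorem theorem3p1
  (mu gamma : R) (rho0 u0 e0 : R -> R)
  (lam5 lam6 lam7 lam8 : R)
  (Hmu : 0 < mu) (Hgamma : 1 < gamma)
  (Hrho0c : cont_I rho0)
  (Hrho0pos : forall x, 0 < x < 1 -> 0 < rho0 x)
  (Hrho0bd : rho0 0 = 0 /\ rho0 1 = 0)
  (Hu0c : cont_I u0) (He0c : cont_I e0)
  (He0nn : forall x, 0 < x < 1 -> 0 <= e0 x)
  (He0nz : exists x, 0 < x < 1 /\ e0 x <> 0)
  (H5 : 0 < lam5) (H6 : 0 < lam6)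
  (H7 : 0 < lam7 < 1) (H8 : 0 < lam8 < 1)
  (Hcase :
     ((forall x, 0 < x < lam7 -> exists dr de,
          derivable_pt_lim rho0 x dr /\ derivable_pt_lim e0 x de /\
          dr / rho0 x + de / rho0 x >= lam5) /\
      u0 lam7 < 0 /\ (forall x, 0 < x < lam7 -> u0 x <= 0))
     \/
     ((forall x, lam8 < x < 1 -> exists dr de,
          derivable_pt_lim rho0 x dr /\ derivable_pt_lim e0 x de /\
          dr / rho0 x + de / rho0 x <= - lam6) /\
      u0 lam8 > 0 /\ (forall x, lam8 < x < 1 -> u0 x >= 0))) :
  forall T, 0 < T ->
    ~ exists rho u e : R -> R -> R, is_C21_solution mu gamma T rho0 u0 e0 rho u e.
Proof.
intros T HT (rho & u & e & Hsol).
destruct Hcase as [[_ [Hl Hle]] | [_ [Hl Hle]]].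
- now apply (no_solution_left mu gamma T lam7) in Hsol.
- apply is_C21_solution_reflect in Hsol; revert Hsol.
  (* The reflected velocity [- u0 (1 - x)] is negative at [1 - lam8] and nonpositive to its left. *)
  apply (no_solution_left mu gamma T (1 - lam8)); try assumption; try lra.
  + intros x Hx; apply Hrho0pos; lra.
  + intros x Hx; apply He0nn; lra.
  + replace (1 - (1 - lam8)) with lam8 by ring; lra.
  + intros x Hx; specialize (Hle (1 - x) ltac:(lra)); lra.
Qed.
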